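(* The kernels $\mathcal{K}^{\mathrm{Pk}}$ and $\mathcal{K}^{\mathrm{pk}}$ of the peak set and peak number statistics are spanned (as $\mathbb{Q}$-vector spaces) in the following ways: (a) $\mathcal{K}^{\mathrm{Pk}}=\mathrm{span}\left(\{M_J+M_K : J\triangleright_1K\text{ or }J\triangleright_2K\}\cup\{M_J : J\in\tilde{\mathcal{C}}\}\right)$; (b) $\mathcal{K}^{\mathrm{pk}}=\mathrm{span}\left(\{M_J+M_K : J\triangleright_1K\text{ or }J\triangleright_2K\}\cup\{M_J : J\in\tilde{\mathcal{C}}\}\cup\{M_J-M_K : J\rightarrow_3K\}\right)$. Here $J,K$ range over all compositions. Therefore, $\mathrm{Pk}$ and $\mathrm{pk}$ are $M$-binomial.
   Context: A permutation of length $n$ is a word $\pi=\pi_1\cdots\pi_n$ of $n$ distinct positive integers. Its descent composition is the composition whose parts are the lengths of its maximal increasing consecutive subsequences, in order. An index $i\in\{2,\dots,n-1\}$ is a peak of $\pi$ if $\pi_{i-1}<\pi_i>\pi_{i+1}$; $\mathrm{Pk}\,\pi$ is the set of peaks and $\mathrm{pk}\,\pi$ the number of peaks. Both depend only on the descent composition, so for a composition $L$ write $\mathrm{Pk}\,L$, $\mathrm{pk}\,L$ for their values on any permutation with descent composition $L$. For $\mathrm{st}\in\{\mathrm{Pk},\mathrm{pk}\}$, compositions $J,K$ satisfy $J\sim_{\mathrm{st}}K$ if $\mathrm{st}\,J=\mathrm{st}\,K$ and $|J|=|K|$ ($|L|$ is the sum of the parts; the empty composition of $0$ is allowed). For $L=(j_1,\dots,j_m)$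 with $|L|=n$, let $\mathrm{Des}\,L=\{j_1,j_1+j_2,\dots,j_1+\cdots+j_{m-1}\}$ and $F_L=\sum x_{i_1}\cdots x_{i_n}$, summed over positive integers $i_1\le\cdots\le i_n$ with $i_j<i_{j+1}$ whenever $j\in\mathrm{Des}\,L$; and let $M_L=\sum_{i_1<i_2<\cdots<i_m}x_{i_1}^{j_1}x_{i_2}^{j_2}\cdots x_{i_m}^{j_m}$. Both $\{F_L\}$ and $\{M_L\}$ are bases of the $\mathbb{Q}$-algebra $\mathrm{QSym}$ of quasisymmetric functions. The kernel of $\mathrm{st}$ is $\mathcal{K}^{\mathrm{st}}=\mathrm{span}_{\mathbb{Q}}\{F_J-F_K : J\sim_{\mathrm{st}}K\}$. (It is known that $\mathcal{K}^{\mathrm{Pk}}$ and $\mathcal{K}^{\mathrm{pk}}$ are ideals of $\mathrm{QSym}$; this is not part of the claim.) The statistic $\mathrm{st}$ is $M$-binomial if $\mathcal{K}^{\mathrm{st}}$ can be spanned by elements of the form $\lambda M_J+\mu M_K$ with $\lambda,\mu\in\mathbb{Q}$ and $J,K$ compositions. For compositions $J=(j_1,\dots,j_m)$ and $K$, with $[m]=\{1,\dots,m\}$: - $J\triangleright_1K$ if there exists $l\in[m]$ with $j_l>2$ and $K=(j_1,\dots,j_{l-1},2,j_l-2,j_{l+1},\dots,j_m)$; - $J\triangleright_2K$ if $j_m=2$ and for some $l\in[m-1]$ we have $j_l=2$ and $K=(j_1,\dots,j_{l-1},1,1,j_{l+1},\dots,j_{m-1},2)$; - $J\in\tilde{\mathcal{C}}$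 if $J=(1^{m-1},2)$, i.e. $m-1$ parts equal to $1$ followed by a part $2$, for some $m\ge1$ (so $(2)\in\tilde{\mathcal{C}}$); - $J\rightarrow_3K$ if $j_i\le2$ for all $i\in[m]$, $j_m=1$, and for some $l\in[m-2]$ we have $j_l=1$, $j_{l+1}=2$ and $K=(j_1,\dots,j_{l-1},j_{l+1},j_l,j_{l+2},\dots,j_m)$. *)

(* Defs.v *)
From HB Require Import structures.
From mathcomp Require Import all_boot all_order all_algebra finmap.
From mathcomp Require Import boolp classical_sets functions cardinality fsbigop.
From mathcomp Require Import monalg zify.

Set Implicit Arguments.
Unset Strict Implicit.
Unset Printing Implicit Defensive.

Import GRing.Theory.

Local Open Scope classical_set_scope.
Local Open Scope ring_scope.

Definition lin_span (V : lmodType rat) (A : set V) : set V :=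
  [set v | exists (n : nat) (c : 'I_n -> rat) (a : 'I_n -> V),
     (forall i, A (a i)) /\ v = \sum_(i < n) c i *: a i].

Definition is_perm_word (p : seq nat) : bool := uniq p && all (ltn 0%N) p.

Definition is_comp (L : seq nat) : bool := all (ltn 0%N) L.

                                                                     
Definition runs (p : seq nat) : seq (seq nat) :=
  foldr (fun x rs =>
    if rs is (y :: r) :: rs' then
      if (x < y)%N then (x :: y :: r) :: rs' else [:: x] :: rs
    else [:: [:: x]]) [::] p.

Definition descent_comp (p : seq nat) : seq nat := shape (runs p).

                                                                  
Definition letter (p : seq nat) (i : nat) : nat := nth 0%N p i.-1.

                                         
Definition Pk (p : seq nat) : {fset nat} :=
  [fset i in iota 2 (size p - 2)
    | (letter p i.-1 < letter p i)%N && (letter p i.+1 < letter p i)%N]%fset.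

Definition pk (p : seq nat) : nat := #|` Pk p |.

                                                                               
                                                                              
                                               
Definition comp_stat (T : Type) (st : seq nat -> T) (L : seq nat) : T :=
  st (xget [::] [set p | is_perm_word p /\ descent_comp p = L]).

Definition st_equiv (T : Type) (st : seq nat -> T) (J K : seq nat) : Prop :=
  comp_stat st J = comp_stat st K /\ sumn J = sumn K.

Definition Des (L : seq nat) : seq nat :=
  [seq sumn (take k L) | k <- iota 1 (size L).-1].

                                                  
Definition series := {cmonom nat} -> rat^o.

                                                                               
                                                                              
Definition monomial_sum (I : choiceType) (A : set I) (u : I -> {cmonom nat}) :
  series := fun m => \sum_(i \in A) ((u i == m)%:R : rat).

Definition qsymF (L : seq nat) : series :=
  monomial_sum
    [set w : seq nat |
      [/\ size w = sumn L, all (ltn 0%N) w, sorted leq w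
        & forall j, j \in Des L -> (letter w j < letter w j.+1)%N]]
    (fun w => \big[mmul/mone]_(i <- w) ucm i).

Definition qsymM (L : seq nat) : series :=
  monomial_sum
    [set w : seq nat | [/\ size w = size L, all (ltn 0%N) w & sorted ltn w]]
    (fun w => \big[mmul/mone]_(ij <- zip w L) expcmn (ucm ij.1) ij.2).

Definition stat_kernel (T : Type) (st : seq nat -> T) : set series :=
  lin_span [set f | exists J K,
    [/\ is_comp J, is_comp K, st_equiv st J K & f = qsymF J - qsymF K]].

Definition M_binomial (T : Type) (st : seq nat -> T) : Prop :=
  exists A : set series,
    (forall f, A f -> exists (l m : rat) (J K : seq nat),
       [/\ is_comp J, is_comp K & f = l *: qsymM J + m *: qsymM K])
    /\ stat_kernel st = lin_span A.

Definition tri1 (J K : seq nat) : Prop :=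
  exists s j t, [/\ J = s ++ j :: t, (2 < j)%N
                  & K = s ++ [:: 2; j - 2]%N ++ t].

Definition tri2 (J K : seq nat) : Prop :=
  exists s t, J = s ++ [:: 2]%N ++ t ++ [:: 2]%N /\
              K = s ++ [:: 1; 1]%N ++ t ++ [:: 2]%N.

Definition in_Ctilde (J : seq nat) : Prop :=
  exists m, (0 < m)%N /\ J = rcons (nseq m.-1 1%N) 2%N.

Definition arrow3 (J K : seq nat) : Prop :=
  all (fun j => (j <= 2)%N) J /\
  exists s t, J = s ++ [:: 1; 2]%N ++ t ++ [:: 1]%N /\
              K = s ++ [:: 2; 1]%N ++ t ++ [:: 1]%N.

Definition tri_sums : set series :=
  [set f | exists J K, [/\ is_comp J, is_comp K, tri1 J K \/ tri2 J K
                         & f = qsymM J + qsymM K]].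

Definition Ctilde_terms : set series :=
  [set f | exists J, [/\ is_comp J, in_Ctilde J & f = qsymM J]].

Definition arrow3_diffs : set series :=
  [set f | exists J K, [/\ is_comp J, is_comp K, arrow3 J K
                         & f = qsymM J - qsymM K]].

Local Open Scope nat_scope.

Lemma runs_cons x p : exists r rs, runs (x :: p) = (x :: r) :: rs.
Proof.
rewrite /=; case: (runs p) => [|[|y r] rs]; try by exists [::], [::].
by case: ifP => _; [exists (y :: r), rs | exists [::], ((y :: r) :: rs)].
Qed.

Lemma runs_cons2 x y r rs p : runs (y :: p) = (y :: r) :: rs ->
  runs [:: x, y & p] =
    if x < y then [:: x, y & r] :: rs else [:: [:: x], y :: r & rs].
Proof. by rewrite {1}/runs /= => ->. Qed.

Fixpoint asc_bits (L : seq nat) : seq bool :=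
  if L is j :: L' then
    nseq j.-1 true ++ (if L' is [::] then [::] else false :: asc_bits L')
  else [::].

Lemma asc_bits_descent_comp x p :
  asc_bits (descent_comp (x :: p)) = pairmap ltn x p.
Proof.
elim: p x => [|y p IH] x //; have [r [rs E]] := runs_cons y p.
have:= IH y; rewrite /descent_comp (runs_cons2 x E) E /= => <-.
by case: ifP.
Qed.

Lemma sumn_descent_comp p : sumn (descent_comp p) = size p.
Proof.
elim: p => [|x [|y p] IH] //; have [r [rs E]] := runs_cons y p.
move: IH; rewrite /descent_comp (runs_cons2 x E) E /=.
by case: ifP => _ /=; lia.
Qed.

Lemma Pk_descent_comp p q : is_perm_word p -> is_perm_word q ->
  descent_comp p = descent_comp q -> Pk p = Pk q.
Proof.
move=> pP qP E.
have szE : size p = size q by rewrite -!sumn_descent_comp E.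
have ascE i : i.+1 < size p ->
    (nth 0 p i < nth 0 p i.+1) = (nth 0 q i < nth 0 q i.+1).
  case: p q E szE {pP qP} => [|x p] [|y q] //= E [szE] ip.
  have /(congr1 (nth false ^~ i)) : pairmap ltn x p = pairmap ltn y q.
    by rewrite -!asc_bits_descent_comp E.
  by rewrite !(nth_pairmap 0) -?szE.
have desc r i : is_perm_word r -> i.+1 < size r ->
    (nth 0 r i.+1 < nth 0 r i) = ~~ (nth 0 r i < nth 0 r i.+1).
  move=> /andP[ur _] ir; rewrite -leqNgt [RHS]leq_eqVlt nth_uniq ?(ltnW ir) //.
  by rewrite (gtn_eqF (ltnSn i)).
apply/fsetP => i; rewrite !inE /= szE.
case: (boolP (i \in _)) => //=; rewrite mem_iota => /andP[i2 ilt].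
have [k Ek] : exists k, i = k.+2 by exists i.-2; lia.
rewrite Ek in ilt *; rewrite /letter /=.
by rewrite ascE ?szE ?desc ?ascE ?szE //; lia.
Qed.

Lemma runs_iota a j p : 0 < j -> head 0 p < a ->
  runs (iota a j ++ p) = iota a j :: runs p.
Proof.
elim: j a => [|[|j] IH] a // _ pa; last first.
  have E := IH a.+1 isT (leqW pa).
  by rewrite [LHS](@runs_cons2 a a.+1 (iota a.+2 j) (runs p)) ?ltnSn.
case: p {IH} pa => [|y p] // pa; have [r [rs E]] := runs_cons y p.
by rewrite [LHS](@runs_cons2 a y r rs) // ltnNge (ltnW pa) E.
Qed.

Lemma descent_comp_surj L : is_comp L ->
  exists p, is_perm_word p /\ descent_comp p = L.
Proof.
move=> LP; suff [p [pP pL _]] : exists p, [/\ is_perm_word p, descent_comp p = L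
    & all (fun x => x <= sumn L) p] by exists p.
elim: L LP => [|j L IH] /=; first by exists [::].
move=> /andP[j0 /IH[p [/andP[up p0] pL pb]]].
exists (iota (sumn L).+1 j ++ p); split.
- rewrite /is_perm_word cat_uniq iota_uniq up all_cat p0 !andbT /=.
  apply/andP; split; last first.
    by apply/allP => x; rewrite mem_iota /= => /andP[]; lia.
  by apply/hasPn => x /(allP pb); rewrite mem_iota; lia.
- rewrite /descent_comp runs_iota //= ?size_iota -/(descent_comp p) ?pL //.
  by case: p pb {up p0 pL} => //= x p /andP[xp _].
- rewrite all_cat; apply/andP; split; apply/allP => x.
    by rewrite mem_iota; lia.
  by move=> /(allP pb); lia.
Qed.

Lemma Pk_comp p : is_perm_word p -> comp_stat Pk (descent_comp p) = Pk p.
Proof.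
move=> pP; rewrite /comp_stat; case: xgetP => [q _ [qP qp]|/(_ p) []//].
exact: Pk_descent_comp.
Qed.

Lemma pk_comp p : is_perm_word p -> comp_stat pk (descent_comp p) = pk p.
Proof. by move=> pP; rewrite /pk -(Pk_comp pP). Qed.

(* Main.v *)
(** A word over the letters A (weak), D (strict) and E (equality) of length [n]
prescribes how consecutive entries of a sequence [v_1 .. v_n] compare, and
[wordX] is the generating function of these sequences.  Fundamental functions
are the words in A and D, monomial ones the words in E and D, and [wordX] is
additive for the rule A = E + D.  Two words in A and D have the same peak set iff
they are linked by turning P A A Q into P D A Q, where P is empty or ends in D;
so the kernel of [Pk] is spanned by the P E A Q, and expanding every A as E + D
turns these into the sums [J |>_1 K] and the [M_J] with last part 2, which
[|>_1] and [|>_2] reduce to the terms of C-tilde.  Modulo this kernel each word is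
a product of blocks D and AD followed by D; equal peak number means equal up to
permuting the blocks, and DAD - ADD = DED - EDD gives the differences of [->_3]. *)

Require Import Defs.
From mathcomp Require Import all_boot all_order all_algebra finmap.
From mathcomp Require Import boolp classical_sets functions.
From mathcomp Require Import fsbigop monalg zify.

Set Implicit Arguments.
Unset Strict Implicit.
Unset Printing Implicit Defensive.

Import GRing.Theory.

Local Open Scope ring_scope.
Local Open Scope classical_set_scope.

(** * Words in three letters and their generating functions *)

Local Notation letA := (Some true).
Local Notation letD := (Some false).
Local Notation letE := (@None bool).

Definition letter_rel (x : option bool) : rel nat :=
  match x with None => @eq_op nat | Some true => leq | Some false => ltn end.

(* The entry after the last one counts as infinite, so a final [letE] cannot be
   satisfied, while a final [letA] or [letD] is no constraint. *)
Fixpoint fits (p : seq (option bool)) (v : seq nat) : bool :=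
  match p, v with
  | [::], [::] => true
  | x :: p', a :: v' =>
      (if v' is b :: _ then letter_rel x a b else x != letE) && fits p' v'
  | _, _ => false
  end.

Definition word_monom (v : seq nat) : {cmonom nat} := \big[mmul/mone]_(i <- v) ucm i.

(** A sequence that fits [p] is weakly increasing, hence determined by its monomial; every
    coefficient is therefore 0 or 1, and an indicator suffices. *)
Definition wordX (p : seq (option bool)) : series :=
  fun m => `[< exists v, [/\ fits p v, all (ltn 0%N) v & word_monom v = m] >]%:R.

Lemma word_monomE v i : word_monom v i = count_mem i v.
Proof.
rewrite /word_monom; elim: v => [|a v IH]; first by rewrite big_nil onecmE.
by rewrite big_cons mulcmE ucmE IH.
Qed.

Lemma word_monom_inj v w : sorted leq v -> sorted leq w ->
  word_monom v = word_monom w -> v = w.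
Proof.
move=> sv sw E; apply: (sorted_eq leq_trans anti_leq) => //.
by apply/allP => i _; rewrite /= -!word_monomE E.
Qed.

Lemma fits_sorted p v : fits p v -> sorted leq v.
Proof.
elim: p v => [|x p IH] [|a [|b v]] //= /andP[ab /IH /= ->]; rewrite andbT.
by case: x ab => [[]|] //= => [/ltnW|/eqP->].
Qed.

(** Inside a sequence, a <= b is the disjoint union of a = b and a < b; at the last entry E fails
    while A and D both hold, so the rule persists there. *)
Lemma fits_split P Q v :
  (fits (P ++ letA :: Q) v =
    fits (P ++ letE :: Q) v || fits (P ++ letD :: Q) v)
  * (fits (P ++ letE :: Q) v && fits (P ++ letD :: Q) v = false).
Proof.
elim: P v => [|x P IH] [|a v] //=.
  case: v => [|b v] /=; first by case: fits.
  rewrite -andb_orl -leq_eqVlt; split=> //; apply/negP.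
  by case/andP=> /andP[/eqP-> _] /andP[]; rewrite ltnn.
by rewrite -andb_orr -IH; split=> //; rewrite andbACA IH andbF.
Qed.

Definition multilinear (f : seq (option bool) -> series) :=
  forall P Q, f (P ++ letA :: Q) = f (P ++ letE :: Q) + f (P ++ letD :: Q).

Lemma wordX_multilinear : multilinear wordX.
Proof.
move=> P Q; apply/funext => m; rewrite /wordX [RHS]/GRing.add /=.
have [[v [vP v0 vm]]|nA] := asboolP; last first.
  have [[v [vP v0 vm]]|_] := asboolP.
    by case: nA; exists v; rewrite fits_split vP.
  have [[v [vP v0 vm]]|_] := asboolP; last by rewrite addr0.
  by case: nA; exists v; rewrite fits_split vP orbT.
(* The monomial [m] leaves [v] as the only candidate, so the remaining indicators become Boolean
   tests at [v]. *)
have uniq_v R w : fits R w -> word_monom w = m -> w = v.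
  move=> wP wm; apply: (word_monom_inj (fits_sorted wP) (fits_sorted vP)).
  by rewrite wm vm.
have ex R : (exists w, [/\ fits R w, all (ltn 0%N) w & word_monom w = m])
    = (fits R v) :> Prop.
  apply/propext; split=> [[w [wP _ wm]]|vR]; last by exists v.
  by rewrite -(uniq_v R w).
rewrite !ex !asboolb; have [+ +] := fits_split P Q v; rewrite vP.
by case: fits; case: fits => // _ _; rewrite ?addr0 ?add0r.
Qed.

Lemma wordX_lastE P : wordX (rcons P letE) = 0.
Proof.
apply/funext => m; rewrite /wordX; case: asboolP => // -[v [vP _ _]].
suff : fits (rcons P letE) v = false by rewrite vP.
elim: P v {vP} => [|x P IH] [|a v] //=; last by rewrite IH andbF.
by case: v => [|b v] //=; rewrite andbF.
Qed.

Lemma wordX_lastA P : wordX (rcons P letA) = wordX (rcons P letD).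
Proof. by rewrite -!cats1 wordX_multilinear cats1 wordX_lastE add0r. Qed.

(** * Monomial functions as words in E and D *)

Lemma monomial_sum_inj (I : choiceType) (A : set I) (u : I -> {cmonom nat}) m :
  {in A &, injective u} ->
  monomial_sum A u m = `[< exists2 i, A i & u i = m >]%:R.
Proof.
move=> inj; rewrite /monomial_sum; case: asboolP => [[i Ai <-]|nA].
  (* Injectivity cuts the support down to [i], so the convention that an infinitely supported sum is
     0 does not interfere. *)
  rewrite -(@fsbig_widen _ _ _ _ [set i]) ?fsbig_set1 ?eqxx //.
    by move=> j /= ->.
  move=> j [Aj /= ij]; case: eqP => // uij; case: ij; apply: inj => //; exact/mem_set.
by rewrite fsbig1 // => i Ai; case: eqP => // E; case: nA; exists i.
Qed.

(** The D closing the last part is no constraint; thanks to it all parts give blocks of the same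
    shape. *)
Definition mword (L : seq nat) : seq (option bool) :=
  flatten [seq rcons (nseq j.-1 letE) letD | j <- L].

Lemma is_comp_cons j L : is_comp (j :: L) = (0 < j)%N && is_comp L.
Proof. by []. Qed.

Lemma is_comp_cat L L' : is_comp (L ++ L') = is_comp L && is_comp L'.
Proof. exact: all_cat. Qed.

Definition repeat_word (w L : seq nat) : seq nat :=
  flatten [seq nseq ij.2 ij.1 | ij <- zip w L].

Lemma repeat_word_monom w L :
  \big[mmul/mone]_(ij <- zip w L) expcmn (ucm ij.1) ij.2
  = word_monom (repeat_word w L).
Proof.
have expE a n : expcmn (ucm a) n = word_monom (nseq n a).
  apply/eqP/cmP => i; rewrite word_monomE count_nseq /expcmn.
  elim: n => [|[|n] IH]; [by rewrite onecmE muln0 | by rewrite ucmE muln1 |].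
  rewrite -[LHS]/(mulcm (ucm a) (expcmn (ucm a) n.+1) i).
  by rewrite mulcmE [expcmn _ _ _]IH ucmE /= [RHS]mulnS.
have catE u v : word_monom (u ++ v) = mulcm (word_monom u) (word_monom v).
  by apply/eqP/cmP => i; rewrite mulcmE !word_monomE count_cat.
rewrite /repeat_word; elim: (zip w L) => [|ij s IH] /=.
  by rewrite /word_monom !big_nil.
by rewrite big_cons IH catE expE.
Qed.

Lemma fits_mwordP L v : is_comp L ->
  reflect (exists w, [/\ size w = size L, sorted ltn w & v = repeat_word w L])
          (fits (mword L) v).
Proof.
elim: L v => [|j L IH] v.
  move=> _; apply: (iffP idP); first by case: v => // _; exists [::].
  by case=> w [/size0nil-> _ ->].
rewrite is_comp_cons => /andP[j0 L0]; case: j j0 => // j _.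
(* Parts being positive, every entry of [w] occurs in [repeat_word w L], so the next block starts
   with the next entry of [w]. *)
have hd w : size w = size L -> head 0%N (repeat_word w L) = head 0%N w
     /\ (repeat_word w L == [::]) = (w == [::]).
  by case: L L0 {IH} w => [|[|k] L] L0 [|a w].
have step a u : fits (mword (j.+1 :: L)) (nseq j.+1 a ++ u) =
    ((u == [::]) || (a < head 0 u)%N) && fits (mword L) u.
  rewrite /mword /=; elim: j => [|j /= ->]; last by rewrite eqxx.
  by case: u.
have only u : fits (mword (j.+1 :: L)) u ->
    exists a u', u = nseq j.+1 a ++ u'.
  rewrite /mword /=; elim: j u {step} => [|j IHj] [|a u] //.
    by exists a, u.
  case: u => [|b u] //= /andP[/eqP<-] /IHj[c [u' E]].
  by exists a, u'; move: E; rewrite /= => -[-> ->].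
apply: (iffP idP).
  move=> vP; have [a [u E]] := only _ vP; move: vP.
  rewrite E step => /andP[hu /(IH u L0)[w [sw ow uE]]].
  exists (a :: w); rewrite /= sw; split=> //; last by rewrite uE.
  move: hu; have [h1 h2] := hd w sw; rewrite uE h1 h2.
  by case: w ow {sw uE h1 h2} => //= b w -> ->.
case=> -[|a w] [] // [sw] ow ->.
have -> : repeat_word (a :: w) (j.+1 :: L) = nseq j.+1 a ++ repeat_word w L by [].
rewrite step; have [-> ->] := hd w sw; apply/andP; split.
  by case: w ow {sw} => //= b w /andP[].
apply/(IH _ L0); exists w; split=> //; exact: path_sorted ow.
Qed.

Lemma repeat_word_inj L w w' : is_comp L -> size w = size L -> size w' = size L ->
  repeat_word w L = repeat_word w' L -> w = w'.
Proof.
elim: L w w' => [|[|j] L IH] [|a w] [|b w'] //= L0 [sw] [sw'].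
by rewrite /repeat_word /= => -[-> /eqP]; rewrite eqseq_cat // eqxx => /eqP/IH ->.
Qed.

Lemma qsymM_wordX L : is_comp L -> qsymM L = wordX (mword L).
Proof.
move=> L0; apply/funext => m; rewrite /qsymM monomial_sum_inj; last first.
  move=> w w' /set_mem[sw _ ow] /set_mem[sw' _ ow'].
  rewrite !repeat_word_monom.
  move=> /word_monom_inj E; apply: (repeat_word_inj L0 sw sw'); apply: E.
    by apply: (@fits_sorted (mword L)); apply/(fits_mwordP _ L0); exists w.
  by apply: (@fits_sorted (mword L)); apply/(fits_mwordP _ L0); exists w'.
have posE w : size w = size L -> all (ltn 0%N) (repeat_word w L) = all (ltn 0%N) w.
  elim: L w L0 => [|[|j] L IH] [|a w] //= L0 [sw].
  rewrite /repeat_word /= all_cat all_nseq.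
  rewrite -/(repeat_word w L) IH //=; case: (0 < a)%N; rewrite ?orbT //=.
rewrite /wordX; congr (nat_of_bool `[< _ >])%:R; apply/propext; split.
  move=> [w [sw w0 ow] <-]; exists (repeat_word w L); split.
  - by apply/(fits_mwordP _ L0); exists w.
  - by rewrite posE.
  - by rewrite repeat_word_monom.
move=> [v [/(fits_mwordP _ L0)[w [sw ow ->]]]]; rewrite posE // => w0 <-.
by exists w; rewrite ?repeat_word_monom.
Qed.

(** * Fundamental functions as words in A and D *)

Definition desc_word (b : seq bool) : seq (option bool) := map Some (rcons b true).

Lemma size_asc_bits L : is_comp L -> size (asc_bits L) = (sumn L).-1.
Proof.
elim: L => [|j [|k L] IH] //; rewrite is_comp_cons => /andP[j0 L0].
  by rewrite /= cats0 size_nseq; lia.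
rewrite [asc_bits _]/= size_cat size_nseq /= -/(asc_bits (k :: L)) IH //=.
by move: L0; rewrite is_comp_cons => /andP[]; lia.
Qed.

Lemma Des_cons j k L :
  Des [:: j, k & L] = j :: [seq (j + i)%N | i <- Des (k :: L)].
Proof.
rewrite /Des /= addn0 -map_comp; congr (_ :: _).
by rewrite (iotaDl 1 1) -map_comp; apply: eq_map => i.
Qed.

Lemma mem_Des L d : is_comp L -> d \in Des L -> (0 < d < sumn L)%N.
Proof.
have pos s : is_comp s -> (0 < size s -> 0 < sumn s)%N.
  by case: s => //= i s /andP[]; lia.
move=> L0 /mapP[k]; rewrite mem_iota => /andP[k0 kL] ->.
have {kL} ks : (k < size L)%N by case: (L) kL => // /(leq_trans k0).
have : is_comp (take k L ++ drop k L) by rewrite cat_take_drop.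
rewrite is_comp_cat => /andP[/pos tP /pos dP].
rewrite tP ?size_take ?ks //= -{2}(cat_take_drop k L) sumn_cat.
by rewrite -{1}[sumn _]addn0 ltn_add2l dP // size_drop subn_gt0.
Qed.

(** Bits are numbered from 0 and descents from 1, hence the shift; bit j - 1 is the [false] that
    separates the first part j from the rest. *)
Lemma nth_asc_bits L i : is_comp L -> (i < (sumn L).-1)%N ->
  nth true (asc_bits L) i = (i.+1 \notin Des L).
Proof.
elim: L i => [|j [|k L] IH] i //; rewrite is_comp_cons => /andP[j0 L0].
  by rewrite /= cats0 nth_nseq; case: ifP.
rewrite Des_cons [asc_bits _]/= nth_cat size_nseq nth_nseq inE negb_or => ilt.
have [ij|ji] := ltnP i j.-1.
  rewrite (_ : i.+1 != j); last by lia.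
  by apply/esym/mapP => -[d _]; lia.
have [->|ne] := eqVneq i j.-1; first by rewrite subnn prednK ?eqxx.
have -> : (i - j.-1)%N = (i - j).+1 by lia.
rewrite -/(asc_bits (k :: L)) [LHS]/= IH //; last by move: ilt => /=; lia.
have -> : i.+1 != j by lia.
have -> : i.+1 = (j + (i - j).+1)%N by lia.
rewrite (mem_map (@addnI j)) //; do 2 f_equal; lia.
Qed.

Lemma fits_desc_word b v : fits (desc_word b) v =
  [&& size v == (size b).+1, sorted leq v
   & all (fun i => nth true b i || (nth 0 v i < nth 0 v i.+1)%N) (iota 0 (size b))].
Proof.
rewrite /desc_word; elim: b v => [|x b IH] [|a [|c v]] //=.
  by rewrite andbF.
rewrite IH (iotaDl 1 0) all_map eqSS.
set T := all _ _.
case: eqP => //= _; rewrite ?andbF //; case: (path leq c v); rewrite ?andbF // !andbT.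
case: T; rewrite ?andbF // !andbT; case: x => /=; rewrite ?andbT //.
by apply/idP/andP => [ac|[]//]; split=> //; apply: ltnW.
Qed.

(** The [true] appended in [desc_word] stands at the unconstrained last position. The empty
    composition is excluded because its word would still have this one letter. *)
Lemma qsymF_wordX L : is_comp L -> L != [::] ->
  qsymF L = wordX (desc_word (asc_bits L)).
Proof.
move=> L0 nL; have sL : (0 < sumn L)%N.
  by case: L L0 nL => //= j L /andP[]; lia.
have fitsE v : fits (desc_word (asc_bits L)) v <->
   [/\ size v = sumn L, sorted leq v
     & forall j, j \in Des L -> (letter v j < letter v j.+1)%N].
  rewrite fits_desc_word size_asc_bits // prednK //; split.
    case/and3P => /eqP sv ov /allP h; split=> // -[|j] jD.
      by have := mem_Des L0 jD.
    have jlt : (j < (sumn L).-1)%N by have := mem_Des L0 jD; lia.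
    have /h : j \in iota 0 (sumn L).-1 by rewrite mem_iota.
    by rewrite nth_asc_bits // jD.
  move=> [sv ov h]; rewrite sv eqxx ov /=; apply/allP => i; rewrite mem_iota => /= ilt.
  by rewrite nth_asc_bits //; case: (boolP (_ \in _)) => //= /h.
apply/funext => m; rewrite /qsymF monomial_sum_inj; last first.
  by move=> v w /set_mem[_ _ ov _] /set_mem[_ _ ow _]; apply: word_monom_inj.
rewrite /wordX; congr (nat_of_bool `[< _ >])%:R; apply/propext; split.
  by move=> [v [sv v0 ov h] <-]; exists v; split=> //; apply/fitsE.
by move=> [v [/fitsE[sv ov h] v0 <-]]; exists v.
Qed.

(** * Subspaces and linear spans *)

Definition subspace (V : lmodType rat) (S : set V) : Prop :=
  S 0 /\ forall c u v, S u -> S v -> S (c *: u + v).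

Section Subspace.
Variables (V : lmodType rat) (S : set V) (SP : subspace S).

Lemma subspaceZ c u : S u -> S (c *: u).
Proof. by move=> Su; rewrite -[_ *: _]addr0; apply: SP.2 => //; apply: SP.1. Qed.

Lemma subspaceD u v : S u -> S v -> S (u + v).
Proof. by move=> Su Sv; rewrite -[u]scale1r; apply: SP.2. Qed.

Lemma subspaceN u : S u -> S (- u).
Proof. by rewrite -scaleN1r; apply: subspaceZ. Qed.

Lemma subspaceB u v : S u -> S v -> S (u - v).
Proof. by move=> Su Sv; apply: subspaceD => //; apply: subspaceN. Qed.

Lemma subspace_sum n (a : 'I_n -> V) : (forall i, S (a i)) -> S (\sum_(i < n) a i).
Proof. by move=> Sa; apply: big_ind => //; [apply: SP.1 | apply: subspaceD]. Qed.

Lemma subspace_trans u v w : S (u - v) -> S (v - w) -> S (u - w).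
Proof. by move=> uv vw; rewrite -[u](subrK v) -addrA; apply: subspaceD. Qed.

Lemma subspace_sym u v : S (u - v) -> S (v - u).
Proof. by move=> /subspaceN; rewrite opprB. Qed.

Lemma subspaceDl u v : S v -> S (u + v) -> S u.
Proof. by move=> Sv Suv; rewrite -[u](addrK v); apply: subspaceB. Qed.

End Subspace.

Lemma lin_span_subspace (V : lmodType rat) (A : set V) : subspace (lin_span A).
Proof.
split; first by exists 0%N, (fun=> 0), (fun=> 0); split=> [[]|]; rewrite ?big_ord0.
move=> k u v [n [c [a [aA ->]]]] [n' [c' [a' [aA' ->]]]].
exists (n + n')%N.
exists (fun i => match fintype.split i with inl j => k * c j | inr j => c' j end).
exists (fun i => match fintype.split i with inl j => a j | inr j => a' j end).
split=> [i|]; first by case: (fintype.split i).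
rewrite big_split_ord scaler_sumr; congr (_ + _); apply: eq_bigr => i _.
  by rewrite (unsplitK (inl i)) scalerA.
by rewrite (unsplitK (inr i)).
Qed.

Lemma mem_lin_span (V : lmodType rat) (A : set V) v : A v -> lin_span A v.
Proof.
move=> Av; exists 1%N, (fun=> 1), (fun=> v); split=> //.
by rewrite big_ord1 scale1r.
Qed.

Lemma lin_span_min (V : lmodType rat) (A S : set V) :
  subspace S -> A `<=` S -> lin_span A `<=` S.
Proof.
move=> SP AS v [n [c [a [aA ->]]]]; apply: subspace_sum => // i.
by apply: subspaceZ => //; apply: AS.
Qed.

(** * Peaks as bit words *)

Fixpoint peak_bits (w : seq bool) : seq bool :=
  if w is x :: w' then (x && ~~ head true w') :: peak_bits w' else [::].

(** Ascent bit k compares entries k + 1 and k + 2, so an ascent there followed by a descent is a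
    peak at k + 2. *)
Definition peak_positions (c : seq bool) : {fset nat} :=
  [fset i in [seq k.+2 | k <- iota 0 (size c) & nth false c k]]%fset.

Lemma size_peak_bits w : size (peak_bits w) = size w.
Proof. by elim: w => //= x w ->. Qed.

Lemma nth_peak_bits w i :
  nth false (peak_bits w) i = nth false w i && ~~ nth true w i.+1.
Proof.
by elim: w i => [|x w IH] [|i] //=; rewrite nth0.
Qed.

Lemma mem_peak_positions c i : (i \in peak_positions c) = (1 < i)%N && nth false c i.-2.
Proof.
rewrite inE /=; apply/mapP/andP => [[k]|].
  by rewrite mem_filter => /andP[ck _] ->.
case: i => [|[|k]] [] // _ /= ck; exists k => //; rewrite mem_filter ck mem_iota /=.
by case: leqP => // ck'; rewrite nth_default in ck.
Qed.

Lemma card_peak_positions c : #|` peak_positions c | = count id c.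
Proof.
rewrite card_fseq undup_id ?size_map ?size_filter.
  have := mkseq_nth false c; rewrite /mkseq => E.
  by rewrite -[in RHS]E count_map; apply: eq_count.
by rewrite map_inj_uniq ?filter_uniq ?iota_uniq // => i j [].
Qed.

Lemma peak_positions_inj c c' : size c = size c' ->
  peak_positions c = peak_positions c' -> c = c'.
Proof.
move=> sc E; apply: (@eq_from_nth _ false) => // i _.
by have := mem_peak_positions c i.+2; rewrite E mem_peak_positions.
Qed.

(** The appended ascent and the default [true] of [peak_bits] create no peak at the end, and for
    nonempty [L] the length becomes |L|; the word thus records the size together with the peak
    set. *)
Definition comp_peaks (L : seq nat) : seq bool := peak_bits (rcons (asc_bits L) true).

Lemma size_comp_peaks L : is_comp L -> L != [::] -> size (comp_peaks L) = sumn L.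
Proof.
move=> L0 nL; rewrite size_peak_bits size_rcons size_asc_bits // prednK //.
by case: L L0 nL => //= j L /andP[]; lia.
Qed.

Lemma Pk_peak_positions p : is_perm_word p -> p != [::] ->
  Pk p = peak_positions (comp_peaks (descent_comp p)).
Proof.
case: p => // x p pP _; apply/fsetP => i; rewrite mem_peak_positions.
rewrite !inE /= mem_iota; case: i => [|[|i]] //=.
rewrite /comp_peaks nth_peak_bits asc_bits_descent_comp !nth_rcons size_pairmap.
rewrite /letter /=.
have [ilt|ige] := ltnP i.+1 (size p); last first.
  (* From the last entry on, the next bit is the appended or the default [true], so there is no
     peak. *)
  rewrite [X in ~~ X](_ : _ = true) ?andbF; last by case: ifP => //; case: eqP.
  by rewrite (_ : (i.+2 < _)%N = false) //; lia.
rewrite (_ : (i.+2 < _)%N = true) ?(ltnW ilt) /=; last by lia.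
rewrite !(nth_pairmap 0%N) ?(ltnW ilt) // [nth 0%N (x :: p) i.+1]/=; congr (_ && _).
case/andP: pP => /= /andP[_ up] _; rewrite -leqNgt [RHS]leq_eqVlt.
by rewrite nth_uniq ?(ltnW ilt) // (gtn_eqF (ltnSn i)).
Qed.

Lemma comp_stat_Pk L : is_comp L -> L != [::] ->
  comp_stat Pk L = peak_positions (comp_peaks L).
Proof.
move=> /descent_comp_surj[p [pP <-]] nL; rewrite Pk_comp // Pk_peak_positions //.
by case: p nL {pP}.
Qed.

Lemma comp_stat_pk L : is_comp L -> L != [::] ->
  comp_stat pk L = count id (comp_peaks L).
Proof.
move=> /descent_comp_surj[p [pP <-]] nL.
rewrite pk_comp // /pk Pk_peak_positions // ?card_peak_positions //.
by case: p nL {pP}.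
Qed.

Lemma st_equiv_Pk J K : is_comp J -> is_comp K -> J != [::] -> K != [::] ->
  st_equiv Pk J K <-> comp_peaks J = comp_peaks K.
Proof.
move=> J0 K0 nJ nK; rewrite /st_equiv !comp_stat_Pk //; split=> [[E s]|E].
  by apply: peak_positions_inj; rewrite ?size_comp_peaks.
by rewrite -!size_comp_peaks // E.
Qed.

(** Bit words are rearrangements of each other exactly when they agree in length and in the number
    of [true]s. *)
Lemma st_equiv_pk J K : is_comp J -> is_comp K -> J != [::] -> K != [::] ->
  st_equiv pk J K <-> perm_eq (comp_peaks J) (comp_peaks K).
Proof.
move=> J0 K0 nJ nK; rewrite /st_equiv !comp_stat_pk // -!size_comp_peaks //.
split=> [[E s]|/permP E]; last by rewrite -!count_predT !E.
apply/permP => a; move: (count_predC id (comp_peaks J)) (count_predC id (comp_peaks K)).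
have cE c : count a c = (a true * count id c + a false * count (predC id) c)%N.
  by elim: c => [|[] c IH] /=; [lia | rewrite IH; lia | rewrite IH; lia].
by rewrite !cE E s; lia.
Qed.

Lemma asc_bits_surj b : exists L, [/\ is_comp L, L != [::] & asc_bits L = b].
Proof.
elim: b => [|x b [[|j L] [//]]]; first by exists [:: 1%N].
rewrite is_comp_cons => /andP[j0 L0] _ E; case: x.
  by exists (j.+1 :: L); split=> //; rewrite -E /=; case: j j0 {E}.
by exists [:: 1%N, j & L]; split=> //; [rewrite !is_comp_cons j0 | rewrite -E].
Qed.

(** Serves both statistics: [R] is equality for [Pk] and [perm_eq] for [pk]. *)
Lemma stat_kernel_wordX (T : Type) (st : seq nat -> T) (R : seq bool -> seq bool -> Prop) :
  (forall J K, is_comp J -> is_comp K -> J != [::] -> K != [::] ->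
    st_equiv st J K <-> R (comp_peaks J) (comp_peaks K)) ->
  stat_kernel st = lin_span [set f | exists b c,
    R (peak_bits (rcons b true)) (peak_bits (rcons c true)) /\
    f = wordX (desc_word b) - wordX (desc_word c)].
Proof.
move=> stR; rewrite eqEsubset; split; apply: lin_span_min;
  try exact: lin_span_subspace.
  move=> f [J [K [J0 K0 JK ->]]].
  (* By size, the empty composition is equivalent only to itself, and it contributes 0. *)
  have [[EJ EK]|[nJ nK]] : J = [::] /\ K = [::] \/ J != [::] /\ K != [::].
    have pos L : is_comp L -> L != [::] -> (0 < sumn L)%N.
      by case: L => //= j L /andP[]; lia.
    case: JK (pos J J0) (pos K K0) => _.
    by case: J {J0} => [|j J]; case: K {K0} => [|k K] E;
       [left | move=> _ /(_ isT) | move=> /(_ isT) | right] => //; rewrite -?E // E.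
  - by rewrite EJ EK subrr; apply: (lin_span_subspace _).1.
  - apply: mem_lin_span; exists (asc_bits J), (asc_bits K).
    by rewrite !qsymF_wordX //; split=> //; apply/stR.
move=> f [b [c [bc ->]]]; apply: mem_lin_span.
have [J [J0 nJ EJ]] := asc_bits_surj b; have [K [K0 nK EK]] := asc_bits_surj c.
exists J, K; rewrite !qsymF_wordX // EJ EK; split=> //.
by apply/stR => //; rewrite /comp_peaks EJ EK.
Qed.

(** * Multilinear functions of words, and block words *)

Lemma multilinear_cat f P : multilinear f -> multilinear (fun w => f (P ++ w)).
Proof. by move=> fP R Q; rewrite !catA fP. Qed.

Lemma multilinear_catr f Q : multilinear f -> multilinear (fun w => f (w ++ Q)).
Proof. by move=> fP R R'; rewrite -!catA !cat_cons fP. Qed.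

Lemma multilinearB f g : multilinear f -> multilinear g ->
  multilinear (fun w => f w - g w).
Proof. by move=> fP gP R R'; rewrite fP gP opprD addrACA. Qed.

Section MultilinearSpan.
Variables (S : set series) (SP : subspace S).

(** Any of the three terms in A = E + D is a combination of the other two. *)
Lemma multilinear_letter f x P Q : multilinear f ->
  (forall y, y != x -> S (f (P ++ y :: Q))) -> S (f (P ++ x :: Q)).
Proof.
move=> fP fS; case: x fS => [[]|] fS.
- by rewrite fP; apply: subspaceD => //; apply: fS.
- rewrite -[f _](addKr (f (P ++ letE :: Q))) -fP addrC.
  by apply: subspaceB => //; apply: fS.
- rewrite -[f _](addrK (f (P ++ letD :: Q))) -fP.
  by apply: subspaceB => //; apply: fS.
Qed.

(** Chooses the alphabet: omitting A leads to monomial functions, omitting E to fundamental ones. *)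
Lemma multilinear_span x f Q : multilinear f ->
  (forall R, x \notin R -> S (f R)) -> S (f Q).
Proof.
elim: Q f => [|y Q IH] f fP fS; first exact: fS.
have consS z : z != x -> S (f (z :: Q)).
  move=> zx; apply: (IH (fun w => f (z :: w))) => [|R xR].
    exact: (multilinear_cat [:: z]).
  by apply: fS; rewrite inE negb_or eq_sym zx.
have [->|/consS//] := eqVneq y x.
exact: (@multilinear_letter f x [::]).
Qed.

End MultilinearSpan.

(** The letters are parameters: the same blocks serve bit words and words in D with A or E. *)
Definition blocks (T : Type) (d x : T) (U : seq bool) : seq T :=
  flatten [seq if b then [:: x; d] else [:: d] | b <- U].

Lemma blocks_cat T (d x : T) U V : blocks d x (U ++ V) = blocks d x U ++ blocks d x V.
Proof. by rewrite /blocks map_cat flatten_cat. Qed.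

Lemma map_blocks T T' (h : T -> T') d x U :
  map h (blocks d x U) = blocks (h d) (h x) U.
Proof.
by rewrite /blocks map_flatten -map_comp; congr flatten; apply: eq_map => -[].
Qed.

(** As A D = E D + D D, a block y D is a combination of x D and D D, and D D is again a pair of
    blocks. *)
Lemma blocks_span (S : set series) x y f U : subspace S -> multilinear f ->
  x != letD -> y != letD ->
  (forall V, S (f (blocks letD x V))) -> S (f (blocks letD y U)).
Proof.
move=> SP + xD yD; have [->|xy] := eqVneq y x; first by move=> _ fS.
elim: U f => [|b U IH] f fP fS; first exact: (fS [::]).
case: b; last first.
  apply: (IH (fun w => f (letD :: w))) => [|V]; first exact: (multilinear_cat [:: _]).
  exact: (fS (false :: V)).
apply: (@multilinear_letter S SP f y [::]) => // z zy.
apply: (IH (fun w => f (z :: letD :: w))) => [|V].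
  exact: (multilinear_cat [:: _; _]).
have [->|zx] := eqVneq z x; first exact: (fS (true :: V)).
have -> : z = letD.
  by clear -xD yD xy zy zx; move: x y z xD yD xy zy zx => [[]|] [[]|] [[]|].
exact: (fS [:: false, false & V]).
Qed.

(* The linear form of the relation "prefixes of a maximal run of ascents may be
   turned into descents", which generates peak-set equivalence. *)
Definition run_reducing (S : set series) : Prop :=
  forall P Q, last letD P = letD -> S (wordX (P ++ [:: letE, letA & Q])).

(** * Run-reducing subspaces and the relations on monomial functions *)

Lemma mword_cat L L' : mword (L ++ L') = mword L ++ mword L'.
Proof. by rewrite /mword map_cat flatten_cat. Qed.

Lemma last_mword L : last letD (mword L) = letD.
Proof.
elim/last_ind: L => // L j _.
by rewrite -cats1 mword_cat last_cat /mword /= cats0 last_rcons.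
Qed.

(** Cutting after each D gives the parts; only a final E obstructs, and then [wordX] vanishes. *)
Lemma mword_surj Q : letA \notin Q ->
  (exists2 L, is_comp L & Q = mword L) \/ exists P, Q = rcons P letE.
Proof.
elim: Q => [|x Q IH]; first by left; exists [::].
rewrite inE negb_or => /andP[xA /IH[[L L0 ->]|[P ->]]]; last first.
  by right; exists (x :: P).
case: x xA => [[]|] // _.
  by left; exists (1%N :: L).
case: L L0 => [|j L]; first by right; exists [::].
rewrite is_comp_cons => /andP[j0 L0]; left; exists (j.+1 :: L) => //.
by rewrite /mword /=; case: j j0.
Qed.

Section Triangle.
Variables (S : set series) (SP : subspace S).

(** Take Q empty: the final A of P E A may be read as D, which closes a part 2. *)
Lemma run_reducing_end2 s : run_reducing S -> is_comp s -> S (qsymM (rcons s 2%N)).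
Proof.
move=> SR s0; rewrite qsymM_wordX -cats1 ?is_comp_cat ?s0 // mword_cat.
have := SR (mword s) [::] (last_mword s).
rewrite -{1}(cat1s letE) catA cats1 cats1 wordX_lastA.
by rewrite -cats1 -[rcons _ letE]cats1 -catA.
Qed.

Lemma run_reducing_tri : run_reducing S -> tri_sums `|` Ctilde_terms `<=` S.
Proof.
move=> SR f [[J [K [J0 K0 tri ->]]]|[J [J0 [m [m0 EJ]] ->]]]; last first.
  rewrite EJ in J0 *; apply: run_reducing_end2 => //.
  by move: J0; rewrite -cats1 is_comp_cat => /andP[].
case: tri => [[s [j [t [EJ j2 EK]]]]|[s [t [EJ EK]]]]; last first.
  (* Both compositions related by [tri2] end in 2. *)
  have two u : is_comp (u ++ [:: 2%N]) -> S (qsymM (u ++ [:: 2%N])).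
    rewrite is_comp_cat cats1 => /andP[u0 _]; exact: run_reducing_end2.
  move: J0 K0; rewrite EJ EK !catA => J0 K0.
  by apply: subspaceD => //; apply: two.
rewrite !qsymM_wordX // EJ EK !mword_cat.
case: j j2 {EJ EK} => [|[|[|j]]] // _.
(* E A E^j D = E^(j+2) D + E D E^j D, that is, a part j + 3 plus the parts 2, j + 1. *)
have := SR (mword s) (rcons (nseq j letE) letD ++ mword t) (last_mword s).
by rewrite -(cat1s letE) catA wordX_multilinear -!catA.
Qed.

Hypothesis triS : tri_sums `|` Ctilde_terms `<=` S.

(** Induction moves the parts of [u] into the leading ones: a part 1 joins them, a part 2 becomes 1,
    1 by [tri2], and a larger j is first split into 2, j - 2 by [tri1]. Once [u] is empty, a term of
    C-tilde remains. *)
Lemma tri_end2 s : is_comp s -> S (qsymM (rcons s 2%N)).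
Proof.
suff H n k u : (sumn u <= n)%N -> is_comp u ->
    S (qsymM (nseq k 1%N ++ u ++ [:: 2%N])).
  by move=> s0; rewrite -cats1; apply: (H _ 0%N s (leqnn _)).
have ones i : is_comp (nseq i 1%N) by apply/allP => x /nseqP[->].
elim: n k u => [|n IH] k [|j u].
- move=> _ _; apply: triS; right; exists (nseq k 1%N ++ [:: 2%N]).
  by split=> //; [rewrite is_comp_cat ones | exists k.+1; rewrite cats1].
- by rewrite is_comp_cons; case: j.
- move=> _ _; apply: triS; right; exists (nseq k 1%N ++ [:: 2%N]).
  by split=> //; [rewrite is_comp_cat ones | exists k.+1; rewrite cats1].
rewrite is_comp_cons /= => jn /andP[j0 u0].
have nseqS i v : nseq i 1%N ++ 1%N :: v = nseq i.+1 1%N ++ v.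
  by elim: i => //= i ->.
have two v : (sumn v < n)%N -> is_comp v ->
    S (qsymM (nseq k 1%N ++ 2%N :: v ++ [:: 2%N])).
  move=> vn v0; apply: (subspaceDl SP (v := qsymM (nseq k.+2 1%N ++ v ++ [:: 2%N]))).
    by apply: IH => //; lia.
  apply: triS; left; exists (nseq k 1%N ++ 2%N :: v ++ [:: 2%N]), (nseq k.+2 1%N ++ v ++ [:: 2%N]).
  split=> //; rewrite ?is_comp_cat ?is_comp_cons ?is_comp_cat ?ones ?v0 //.
  by right; exists (nseq k 1%N), v; rewrite -!nseqS.
case: j j0 jn => [|[|[|j]]] // _ jn.
- by rewrite nseqS; apply: IH => //; lia.
- by apply: two => //; lia.
have jn' : (sumn (j.+1 :: u) < n)%N by move: jn => /=; lia.
apply: (subspaceDl SP (two (j.+1 :: u) jn' u0)).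
apply: triS; left; eexists _, _; split; last reflexivity.
- by rewrite is_comp_cat is_comp_cons is_comp_cat ones u0.
- by rewrite is_comp_cat !is_comp_cons is_comp_cat ones u0.
by left; exists (nseq k 1%N), j.+3, (u ++ [:: 2%N]).
Qed.

(** Expanding every A outside the given pair leaves P = [mword L] and Q in E and D. Then E A Q = E E
    Q + E D Q gives zero if Q ends in E, a monomial function with last part 2 if Q is empty, and a
    [tri1] sum otherwise. *)
Lemma tri_run_reducing : run_reducing S.
Proof.
suff H L Q : is_comp L -> S (wordX (mword L ++ [:: letE, letA & Q])).
  move=> P Q; case/lastP: P => [_|P x]; first exact: (H [::]).
  rewrite last_rcons => ->; rewrite -cats1 -catA.
  (* The final D of P is kept out of the expansion, so that P still closes a part. *)
  apply: (@multilinear_span S SP letA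
    (fun w => wordX (w ++ [:: letD] ++ [:: letE, letA & Q]))) => [|R AR].
    exact/multilinear_catr/wordX_multilinear.
  have [|[L L0 E]|[R' /(congr1 (last letD))]] := @mword_surj (rcons R letD).
  - by rewrite mem_rcons inE negb_or.
  - by rewrite catA cats1 E; apply: H.
  - by rewrite !last_rcons.
move=> L0; apply: (@multilinear_span S SP letA
    (fun w => wordX (mword L ++ [:: letE, letA & w]))) => [|{}Q AQ].
  move=> R R'; have := wordX_multilinear.
  by move/(multilinear_cat (mword L ++ [:: letE; letA]))/(_ R R'); rewrite -!catA.
rewrite -(cat1s letE) catA wordX_multilinear -!catA.
have [[t t0 ->]|[R ->]] := mword_surj AQ; last first.
  have zero P : S (wordX (P ++ rcons R letE)).
    by rewrite -rcons_cat wordX_lastE; apply: SP.1.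
  by rewrite -[_ :: rcons _ _]cat1s -[letD :: _]cat1s !catA; apply: subspaceD => //; apply: zero.
case: t t0 => [_|j t].
  have -> : mword L ++ [:: letE] ++ letE :: mword [::] = rcons (rcons (mword L) letE) letE.
    by rewrite -!cats1 -catA.
  rewrite wordX_lastE add0r.
  have := tri_end2 L0; rewrite -cats1 qsymM_wordX ?is_comp_cat ?L0 //.
  by rewrite mword_cat.
rewrite is_comp_cons; case: j => // j t0.
apply: triS; left; exists (L ++ j.+3 :: t), (L ++ [:: 2%N, j.+1 & t]).
split; rewrite ?is_comp_cat ?is_comp_cons ?L0 //.
  by left; exists L, j.+3, t.
by rewrite !qsymM_wordX ?is_comp_cat ?is_comp_cons ?L0 // !mword_cat.
Qed.

End Triangle.

(** * Peak sets and canonical words *)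

Section Kernel.
Variables (S : set series) (SP : subspace S).

(** The word is rewritten from left to right behind a finished prefix P that is empty or ends in D:
    A A becomes D A, since A A - D A = E A, while A D is kept. What remains has an A only at the
    peaks, so it depends on the peak bits alone. *)
Lemma run_reducing_peak_bits w : run_reducing S -> last false w ->
  S (wordX (map Some w) - wordX (map Some (peak_bits w))).
Proof.
move=> SR; rewrite -[map Some w]cat0s -[map Some (peak_bits w)]cat0s.
have : last letD [::] = letD by [].
move: {1 2 3}[::] => P; have [n] := ubnP (size w).
elim: n w P => // n IH [|x [|y w]] P //=.
  case: x => // _ _ _.
  (* A final A may be read as D. *)
  by rewrite !cats1 wordX_lastA subrr; apply: SP.1.
rewrite !ltnS => wn PD wl.
have stepD z v : (size v < size (z :: y :: w))%N -> last false v ->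
    S (wordX (P ++ letD :: map Some v) - wordX (P ++ letD :: map Some (peak_bits v))).
  move=> vw vl; have := IH v (P ++ [:: letD]).
  rewrite -!catA; apply=> //; first by apply: leq_trans wn.
  by rewrite last_cat.
case: x; last exact: (stepD false (y :: w)).
case: y wl stepD => wl stepD.
  apply: subspace_trans (stepD true (true :: w) _ _) => //.
  have := SR P (map Some w) PD; congr S.
  by rewrite wordX_multilinear addrK.
case: w wn wl {stepD} => // y w wn wl.
have := IH (y :: w) (P ++ [:: letA; letD]).
rewrite -!catA; apply=> //; first by move: wn => /=; lia.
by rewrite last_cat.
Qed.

(** Bit [x] precedes an ascent and the bit before it, if any, is a descent, so [x] affects no
    peak. *)
Lemma peak_bits_catAA p q x : last false p = false ->
  peak_bits (p ++ [:: x, true & q]) = peak_bits (p ++ [:: false, true & q]).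
Proof.
elim: p => [|y [|z p] IH] /=; first by rewrite andbF.
  by move=> ->; rewrite /= andbF.
by move=> /IH /= ->.
Qed.

(** Here E is expanded away, and E A = A A - D A becomes a difference of two words with the same
    peak bits. *)
Lemma peak_bits_run_reducing :
  (forall b c, peak_bits (rcons b true) = peak_bits (rcons c true) ->
    S (wordX (desc_word b) - wordX (desc_word c))) -> run_reducing S.
Proof.
move=> bc; suff H p Q : last false p = false ->
    S (wordX (map Some p ++ [:: letE, letA & Q])).
  move=> P Q; case/lastP: P => [_|P x]; first exact: (H [::]).
  rewrite last_rcons => ->; rewrite -cats1 -catA.
  apply: (@multilinear_span S SP letE
    (fun w => wordX (w ++ [:: letD] ++ [:: letE, letA & Q]))) => [|R ER].
    exact/multilinear_catr/wordX_multilinear.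
  have [r ->] : exists r, R = map Some r.
    elim: R ER => [|[x'|] R IH]; rewrite ?inE //=; first by exists [::].
    by move=> /IH[r ->]; exists (x' :: r).
  by rewrite catA cats1 -map_rcons; apply: H; rewrite last_rcons.
move=> pl; apply: (@multilinear_span S SP letE
    (fun w => wordX (map Some p ++ [:: letE, letA & w]))) => [|{}Q EQ].
  move=> R R'; have := wordX_multilinear.
  by move/(multilinear_cat (map Some p ++ [:: letE; letA]))/(_ R R'); rewrite -!catA.
have [q ->] : exists q, Q = map Some q.
  elim: Q EQ => [|[x'|] R IH]; rewrite ?inE //=; first by exists [::].
  by move=> /IH[r ->]; exists (x' :: r).
have -> : wordX (map Some p ++ [:: letE, letA & map Some q]) =
    wordX (map Some (p ++ [:: true, true & q])) -
    wordX (map Some (p ++ [:: false, true & q])).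
  by rewrite !map_cat /= wordX_multilinear addrK.
(* The last letter is no constraint, so any last bit may be traded for the [true] of [desc_word]. *)
have E b x : wordX (map Some (rcons b x)) = wordX (desc_word b).
  by case: x => //; rewrite /desc_word !map_rcons wordX_lastA.
case/lastP: q => [|q x].
  have split2 y : p ++ [:: y; true] = rcons (rcons p y) true by rewrite -!cats1 -catA.
  by rewrite !split2 !E; apply: bc; rewrite -!split2 peak_bits_catAA.
rewrite -!rcons_cons -!rcons_cat !E; apply: bc.
by rewrite !rcons_cat !rcons_cons peak_bits_catAA.
Qed.

End Kernel.

(** * Peak numbers and permutations of blocks *)

Lemma peak_bits_blocks w : last false w ->
  exists U, peak_bits w = rcons (blocks false true U) false.
Proof.
have [n] := ubnP (size w); elim: n w => // n IH [|x [|y w]] //.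
  by case: x => // _ _; exists [::].
rewrite /= !ltnS => wn wl.
have stepD v : (size v < n)%N -> last false v ->
    exists U, false :: peak_bits v = rcons (blocks false true U) false.
  by move=> vn /(IH _ vn)[U ->]; exists (false :: U).
have [/andP[_ yD]|_] := boolP (x && ~~ y); last exact: (stepD (y :: w)).
(* A peak bit is followed by a descent, which is no peak: the two bits form a block A D. *)
case: y yD wl => // _; case: w wn => // y w wn wl.
by have [||U /= ->] := IH (y :: w); rewrite ?(ltnW wn) //; exists (true :: U).
Qed.

Lemma blocks_peak_bits U :
  peak_bits (rcons (blocks false true U) true) = rcons (blocks false true U) false.
Proof. by elim: U => //= -[] U /= IH; rewrite IH. Qed.

(** The letter A counts the blocks A D and the letter D counts all blocks, so letter counts and
    block counts determine each other. *)
Lemma perm_blocks U V :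
  perm_eq (blocks false true U) (blocks false true V) = perm_eq U V.
Proof.
have cE W a : count a (blocks false true W) =
    (a true * count_mem true W + a false * (count_mem true W + count_mem false W))%N.
  rewrite /blocks; elim: W => [|b W IH]; rewrite ?muln0 //=.
  case: b; rewrite /= ?IH;
    by move: (a true) (a false) (count_mem true W) (count_mem false W) => [] []; lia.
apply/permP/permP => UV a; last by rewrite !cE !UV.
have tE : count_mem true U = count_mem true V.
  by have := UV (pred1 true); rewrite !cE /= !mul1n !mul0n !addn0.
have fE : count_mem false U = count_mem false V.
  by have := UV (pred1 false); rewrite !cE tE /= !mul0n !add0n !mul1n => /addnI.
have sE W : count a W = (a true * count_mem true W + a false * count_mem false W)%N.
  elim: W => [|b W IH]; rewrite ?muln0 //= IH; case: b => /=;
    by move: (a true) (a false) (count_mem true W) (count_mem false W) => [] []; lia.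
by rewrite !sE tE fE.
Qed.

(** Adjacent swaps sort [U] and [V] into the same word, all [true]s before all [false]s. *)
Lemma perm_span (S : set series) (g : seq bool -> series) U V : subspace S ->
  (forall P Q, S (g (P ++ [:: false, true & Q]) - g (P ++ [:: true, false & Q]))) ->
  perm_eq U V -> S (g U - g V).
Proof.
move=> SP swap /permP UV.
pose sorted_word n m := nseq n true ++ nseq m false.
suff H W (h : seq bool -> series) :
    (forall P Q, S (h (P ++ [:: false, true & Q]) - h (P ++ [:: true, false & Q]))) ->
    S (h W - h (sorted_word (count_mem true W) (count_mem false W))).
  apply: (subspace_trans SP (H U g swap)); rewrite !UV.
  by apply: (subspace_sym SP); apply: H.
elim: W h => [|b W IH] h hS; first by rewrite subrr; apply: SP.1.
apply: (subspace_trans SP (IH (fun w => h (b :: w)) (fun P => hS (b :: P)))).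
case: b; first by rewrite subrr; apply: SP.1.
rewrite /= add0n add1n /sorted_word; move: (count_mem false W) => m.
(* The leading [false] moves past the [true]s one swap at a time. *)
elim: (count_mem true W) h hS {IH} => [|n IH] h hS; first by rewrite subrr; apply: SP.1.
apply: (subspace_trans SP (hS [::] _)).
exact: (IH (fun w => h (true :: w)) (fun P => hS (true :: P))).
Qed.

Definition block_parts (U : seq bool) : seq nat := [seq (nat_of_bool b).+1 | b <- U].

Lemma mword_block_parts U : mword (block_parts U) = blocks letD letE U.
Proof. by rewrite /mword /block_parts -map_comp; congr flatten; apply: eq_map => -[]. Qed.

Lemma is_comp_block_parts U : is_comp (block_parts U).
Proof. by rewrite /is_comp all_map; apply/allP. Qed.

Lemma block_parts_surj L : is_comp L -> all (fun j => j <= 2)%N L ->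
  exists U, L = block_parts U.
Proof.
elim: L => [|j L IH]; first by exists [::].
rewrite is_comp_cons /= => /andP[j0 L0] /andP[j2 /(IH L0)[U ->]].
by exists ((1 < j)%N :: U); case: j j0 j2 => [|[|[|j]]].
Qed.

(** Expanding the A of either word produces the same D D D, which cancels. *)
Lemma swap_blocksE P R : wordX (P ++ [:: letD, letA, letD & R]) -
    wordX (P ++ [:: letA, letD, letD & R]) =
  wordX (P ++ [:: letD, letE, letD & R]) - wordX (P ++ [:: letE, letD, letD & R]).
Proof.
rewrite [wordX (P ++ letA :: _)]wordX_multilinear.
have := wordX_multilinear (P ++ [:: letD]) (letD :: R); rewrite -!catA /= => ->.
by rewrite opprD addrACA subrr addr0.
Qed.

(** With x = A two adjacent blocks are swapped, with x = E two adjacent parts 1 and 2; by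
    [swap_blocksE] both differences are equal. *)
Definition swap_diff (x : option bool) (U V : seq (option bool)) : series :=
  wordX (U ++ [:: letD, x, letD & V ++ [:: letD]]) -
  wordX (U ++ [:: x, letD, letD & V ++ [:: letD]]).

Lemma swap_diff_span (S : set series) x y z U V : subspace S ->
  x != letD -> y != letD ->
  (forall U V, S (swap_diff z (blocks letD x U) (blocks letD x V))) ->
  S (swap_diff z (blocks letD y U) (blocks letD y V)).
Proof.
move=> SP xD yD H.
have ml P : multilinear (fun w => wordX (P ++ w ++ [:: letD])).
  exact: (multilinear_catr _ (multilinear_cat P wordX_multilinear)).
have mr R : multilinear (fun w => wordX (w ++ R)).
  exact/multilinear_catr/wordX_multilinear.
apply: (blocks_span (f := fun w => swap_diff z w (blocks letD y V)) (x := x)) => //.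
  exact: multilinearB.
move=> U'; apply: (blocks_span (f := fun w => swap_diff z _ w) (x := x)) => //.
apply: multilinearB => R R'.
  by have := ml (blocks letD x U' ++ [:: letD; z; letD]) R R'; rewrite -!catA.
by have := ml (blocks letD x U' ++ [:: z; letD; letD]) R R'; rewrite -!catA.
Qed.

(** Parts 1 and 2 are the blocks D and E D, and the last part 1 is the final D. *)
Lemma arrow3_diffsP f : arrow3_diffs f <->
  exists U V, f = swap_diff letE (blocks letD letE U) (blocks letD letE V).
Proof.
have wE U V :
    qsymM (block_parts U ++ [:: 1; 2]%N ++ block_parts V ++ [:: 1]%N) -
    qsymM (block_parts U ++ [:: 2; 1]%N ++ block_parts V ++ [:: 1]%N) =
    swap_diff letE (blocks letD letE U) (blocks letD letE V).
  rewrite !qsymM_wordX ?is_comp_cat ?is_comp_block_parts //.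
  by rewrite !mword_cat !mword_block_parts -!catA.
split=> [[J [K [J0 K0 [J2 [s [t [EJ EK]]]] ->]]]|[U [V ->]]].
  move: J0 J2; rewrite EJ EK !is_comp_cat !all_cat => /and4P[s0 _ t0 _] /and4P[s2 _ t2 _].
  have [U ->] := block_parts_surj s0 s2; have [V ->] := block_parts_surj t0 t2.
  by exists U, V.
rewrite -wE; eexists _, _; split; last reflexivity.
- by rewrite !is_comp_cat !is_comp_block_parts.
- by rewrite !is_comp_cat !is_comp_block_parts.
split; last by exists (block_parts U), (block_parts V).
have le2 W : all (fun j => j <= 2)%N (block_parts W) by rewrite all_map; apply/allP => -[].
by rewrite !all_cat !le2.
Qed.

Lemma blocks_swap_span (S : set series) U V : subspace S -> arrow3_diffs `<=` S ->
  perm_eq U V ->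
  S (wordX (blocks letD letA U ++ [:: letD]) - wordX (blocks letD letA V ++ [:: letD])).
Proof.
move=> SP AS.
apply: (perm_span (g := fun U => wordX (blocks letD letA U ++ [:: letD]))) => //.
move=> {}U {}V.
have -> : wordX (blocks letD letA (U ++ [:: false, true & V]) ++ [:: letD]) -
    wordX (blocks letD letA (U ++ [:: true, false & V]) ++ [:: letD]) =
    swap_diff letE (blocks letD letA U) (blocks letD letA V).
  by rewrite !blocks_cat /swap_diff -swap_blocksE -!catA.
apply: (swap_diff_span (x := letE)) => // U' V'.
by apply/AS/arrow3_diffsP; exists U', V'.
Qed.

(** The middle E turns into A by [swap_blocksE], and swapping two blocks only permutes the peak
    bits. *)
Lemma arrow3_kernel (S : set series) : subspace S ->
  (forall b c, perm_eq (peak_bits (rcons b true)) (peak_bits (rcons c true)) ->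
    S (wordX (desc_word b) - wordX (desc_word c))) -> arrow3_diffs `<=` S.
Proof.
move=> SP bc f /arrow3_diffsP[U [V ->]].
apply: (swap_diff_span (x := letA)) => // {}U {}V.
have E W : wordX (desc_word (blocks false true W)) = wordX (blocks letD letA W ++ [:: letD]).
  by rewrite /desc_word map_rcons wordX_lastA map_blocks cats1.
have -> : swap_diff letE (blocks letD letA U) (blocks letD letA V) =
    wordX (desc_word (blocks false true (U ++ [:: false, true & V]))) -
    wordX (desc_word (blocks false true (U ++ [:: true, false & V]))).
  by rewrite !E !blocks_cat /swap_diff -swap_blocksE -!catA.
apply: bc; rewrite !blocks_peak_bits perm_rcons perm_sym perm_rcons perm_cons.
rewrite perm_blocks perm_cat2l.
by apply/permP => a /=; lia.
Qed.

(** * The two kernels *)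

Lemma stat_kernel_Pk : stat_kernel Pk = lin_span (tri_sums `|` Ctilde_terms).
Proof.
rewrite (stat_kernel_wordX (R := eq) st_equiv_Pk).
rewrite eqEsubset; split; apply: lin_span_min; try exact: lin_span_subspace.
  have SP := lin_span_subspace (tri_sums `|` Ctilde_terms).
  have SR := tri_run_reducing SP (@mem_lin_span _ _).
  move=> f [b [c [bc ->]]].
  (* Both words are congruent to the same canonical word. *)
  apply: (subspace_trans SP (run_reducing_peak_bits SP (w := rcons b true) SR _)).
    by rewrite last_rcons.
  apply: subspace_sym => //; rewrite bc; apply: run_reducing_peak_bits => //.
  by rewrite last_rcons.
apply: run_reducing_tri; first exact: lin_span_subspace.
apply: peak_bits_run_reducing => [|b c bc]; first exact: lin_span_subspace.
by apply: mem_lin_span; exists b, c.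
Qed.

Lemma stat_kernel_pk :
  stat_kernel pk = lin_span (tri_sums `|` Ctilde_terms `|` arrow3_diffs).
Proof.
rewrite (stat_kernel_wordX (R := perm_eq) st_equiv_pk).
rewrite eqEsubset; split; apply: lin_span_min; try exact: lin_span_subspace.
  set S := lin_span _; have SP : subspace S by exact: lin_span_subspace.
  have SR : run_reducing S.
    by apply: tri_run_reducing => // f Tf; apply: mem_lin_span; left.
  have SA : arrow3_diffs `<=` S by move=> f Af; apply: mem_lin_span; right.
  move=> f [b [c [+ ->]]].
  (* Modulo [S] each word is a product of blocks followed by D. *)
  have red d : exists2 U, peak_bits (rcons d true) = rcons (blocks false true U) false
      & S (wordX (desc_word d) - wordX (blocks letD letA U ++ [:: letD])).
    have dl : last false (rcons d true) by rewrite last_rcons.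
    have [U EU] := peak_bits_blocks dl; exists U => //.
    have := run_reducing_peak_bits SP SR dl.
    by rewrite -/(desc_word d) EU map_rcons map_blocks -cats1.
  have [U -> bU] := red b; have [V -> cV] := red c.
  rewrite perm_rcons perm_sym perm_rcons perm_cons perm_sym perm_blocks => UV.
  apply: (subspace_trans SP bU); apply: (subspace_trans SP (blocks_swap_span SP SA UV)).
  exact: subspace_sym.
set S := lin_span _; have SP : subspace S by exact: lin_span_subspace.
have gen b c : perm_eq (peak_bits (rcons b true)) (peak_bits (rcons c true)) ->
    S (wordX (desc_word b) - wordX (desc_word c)).
  by move=> bc; apply: mem_lin_span; exists b, c.
move=> f [Tf|]; last exact: arrow3_kernel.
apply: run_reducing_tri Tf => //; apply: peak_bits_run_reducing => // b c bc.
by apply: gen; rewrite bc.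
Qed.

Theorem theorem3 :
  [/\ stat_kernel Pk = lin_span (tri_sums `|` Ctilde_terms),
      stat_kernel pk = lin_span (tri_sums `|` Ctilde_terms `|` arrow3_diffs),
      M_binomial Pk
    & M_binomial pk].
Proof.
have binom_tri f : (tri_sums `|` Ctilde_terms) f ->
    exists (l m : rat) J K, [/\ is_comp J, is_comp K & f = l *: qsymM J + m *: qsymM K].
  case=> [[J [K [J0 K0 _ ->]]]|[J [J0 _ ->]]].
    by exists 1, 1, J, K; rewrite !scale1r.
  by exists 1, 0, J, J; rewrite scale1r scale0r addr0.
split; [exact: stat_kernel_Pk | exact: stat_kernel_pk | |].
  by exists (tri_sums `|` Ctilde_terms); split; last exact: stat_kernel_Pk.
exists (tri_sums `|` Ctilde_terms `|` arrow3_diffs).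
split; last exact: stat_kernel_pk.
move=> f [/binom_tri//|[J [K [J0 K0 _ ->]]]].
by exists 1, (-1), J, K; rewrite scale1r scaleN1r.
Qed.
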